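(* Let $j\ge 1$ be an integer, $x>0$, and $m\in\mathbb{N}$, $m\ge1$. Let $A_j(x)$ be the perturbation of the Agler shift $A_j$ in which the zeroth weight $\sqrt{\frac{1}{j}}$ is replaced by $\sqrt{\frac{x}{j}}$ (all other weights unchanged). Then the sequence of squared weights of $A_j(x)$ is $m$-alternating if and only if $$x\le 1+\frac{(j-1)\,m!}{\prod_{i=1}^{m}(j+i)}.$$ In the case $j=2$ (the Bergman shift), the sequence of squared weights of $A_2(x)$ is $m$-alternating if and only if $A_2(x)$ is $\frac{(m+1)(m+2)}{2}$-contractive.
   Context: Weighted shifts: given a bounded sequence $\alpha=(\alpha_n)_{n=0}^\infty$ of positive real numbers, $W_\alpha$ is the bounded operator on $\ell^2(\mathbb{N}_0)$ with $W_\alpha e_n=\alpha_n e_{n+1}$. Its moment sequence $\gamma$ is $\gamma_0:=1$, $\gamma_n:=\prod_{i=0}^{n-1}\alpha_i^2$ for $n\ge1$. For $j=1,2,\ldots$, the Agler shift $A_j$ is the weighted shift with weights $\sqrt{\frac{n+1}{n+j}}$, $n=0,1,\ldots$. A real sequence $(a_k)_{k\ge0}$ is $m$-alternating if $\sum_{i=0}^m(-1)^i\binom{m}{i}a_{k+i}\le 0$ for all $k\ge0$. A weighted shift with moment sequence $\gamma$ is $n$-contractive ($n\ge1$) if $\sum_{i=0}^n(-1)^i\binom{n}{i}\gamma_{\ell+i}\ge 0$ for all $\ell\ge 0$. *)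

(* Defs.v *)
From mathcomp Require Import all_boot all_order all_algebra.
From mathcomp Require Import reals.

Set Implicit Arguments.
Unset Strict Implicit.
Unset Printing Implicit Defensive.

Import Order.TTheory GRing.Theory Num.Theory.
Local Open Scope ring_scope.

(* The shift [W e_n = weight n * e_(n+1)] on l^2 is determined by its weight
   sequence; every notion below is defined from the weights. *)
Record weighted_shift (R : realType) := WeightedShift {
  weight : nat -> R;
  weight_gt0 : forall n, 0 < weight n;
  weight_bounded : exists M : R, forall n, weight n <= M
}.

Definition squared_weights (R : realType) (W : weighted_shift R) : nat -> R :=
  fun n => weight W n ^+ 2.

Definition moment (R : realType) (W : weighted_shift R) (n : nat) : R :=
  \prod_(0 <= i < n) weight W i ^+ 2.

Definition alternating (R : realType) (m : nat) (a : nat -> R) : Prop :=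
  forall k : nat,
    \sum_(0 <= i < m.+1) (-1) ^+ i * 'C(m, i)%:R * a (k + i)%N <= 0.

Definition contractive (R : realType) (n : nat) (W : weighted_shift R) : Prop :=
  forall l : nat,
    0 <= \sum_(0 <= i < n.+1) (-1) ^+ i * 'C(n, i)%:R * moment W (l + i)%N.

Section Agler.
Variables (R : realType) (j : nat) (j_ge1 : (1 <= j)%N).

Definition agler_weight (n : nat) : R := Num.sqrt (n.+1%:R / (n + j)%:R).

Lemma agler_weight_gt0 n : 0 < agler_weight n.
Proof. by rewrite sqrtr_gt0 divr_gt0 ?ltr0n // addn_gt0 j_ge1 orbT. Qed.

Lemma agler_weight_bounded : exists M : R, forall n, agler_weight n <= M.
Proof.
exists 1 => n; rewrite -[leRHS]sqrtr1 ler_sqrt ?ltr01 //.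
by rewrite ler_pdivrMr ?ltr0n ?addn_gt0 ?j_ge1 ?orbT // mul1r ler_nat -addn1 leq_add2l.
Qed.

Definition agler_shift : weighted_shift R :=
  WeightedShift agler_weight_gt0 agler_weight_bounded.

End Agler.

Section Perturbation.
Variables (R : realType) (W : weighted_shift R) (c : R) (c_gt0 : 0 < c).

Definition perturbed_weight (n : nat) : R := if n is 0 then c else weight W n.

Lemma perturbed_weight_gt0 n : 0 < perturbed_weight n.
Proof. by case: n => [//|n]; apply: weight_gt0. Qed.

Lemma perturbed_weight_bounded : exists M : R, forall n, perturbed_weight n <= M.
Proof.
have [M leM] := weight_bounded W.
by exists (Num.max c M) => -[|n] /=; rewrite le_max ?lexx // leM orbT.
Qed.

Definition perturb_weight0 : weighted_shift R :=
  WeightedShift perturbed_weight_gt0 perturbed_weight_bounded.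

End Perturbation.

Lemma sqrt_div_nat_gt0 (R : realType) (j : nat) (x : R) :
  (1 <= j)%N -> 0 < x -> 0 < Num.sqrt (x / j%:R).
Proof. by move=> j_ge1 x_gt0; rewrite sqrtr_gt0 divr_gt0 ?ltr0n. Qed.

Definition perturbed_agler (R : realType) (j : nat) (j_ge1 : (1 <= j)%N)
    (x : R) (x_gt0 : 0 < x) : weighted_shift R :=
  perturb_weight0 (agler_shift R j_ge1) (sqrt_div_nat_gt0 j_ge1 x_gt0).

(* Main.v *)
(* Both families of inequalities are sign conditions on the alternating
   differences [sum_i (-1)^i C(n, i) u_(k+i)].  Since
   [sum_i (-1)^i C(n, i) / (a + i) = n! / (a (a + 1) ... (a + n))], these
   differences are explicit for the squared weights [1 - (j - 1) / (n + j)] and,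
   when [j = 2], for the moments [x / (n + 1)].  For [k >= 1] they always have
   the required sign; at [k = 0] only the term [i = 0] differs from the
   unperturbed pattern, and the inequality becomes the stated bound on [x].
   For [j = 2] both bounds read [x <= 1 + 1 / N], [N = (m + 1)(m + 2) / 2]. *)
Require Import Defs.
From mathcomp Require Import all_boot all_order all_algebra.
From mathcomp Require Import reals.
From mathcomp Require Import ring lra.

Import Order.TTheory GRing.Theory Num.Theory.
Local Open Scope ring_scope.

(** This is $((I-S)^n u)(0)$ for the shift $S$. Evaluation at 0 suffices: the inequality at $k$ is
    the same expression for the sequence shifted by $k$. *)
Definition altdiff (R : pzRingType) (n : nat) (u : nat -> R) : R :=
  \sum_(0 <= i < n.+1) (-1) ^+ i * 'C(n, i)%:R * u i.

(** Pascal's rule, or $(I-S)^{n+1} = (I-S)^n - (I-S)^n S$. *)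
Lemma altdiffS (R : pzRingType) (n : nat) (u : nat -> R) :
  altdiff R n.+1 u = altdiff R n u - altdiff R n (fun i => u i.+1).
Proof.
rewrite /altdiff big_nat_recl // [X in X - _]big_nat_recl // !bin0 -addrA.
congr (_ + _).
under eq_bigr => i _ do rewrite binS natrD mulrDr mulrDl exprS mulN1r.
rewrite big_split /= big_nat_recr //= bin_small // mulr0 mul0r addr0.
congr (_ + _); last by rewrite -sumrN; apply: eq_bigr => i _; rewrite !mulNr.
by apply: eq_bigr => i _; rewrite exprS mulN1r.
Qed.

Lemma eq_altdiff (R : pzRingType) (n : nat) (u v : nat -> R) :
  u =1 v -> altdiff R n u = altdiff R n v.
Proof. by move=> uv; apply: eq_bigr => i _; rewrite uv. Qed.

(** The entry at 0 has coefficient 1. This isolates the effect of the perturbation. *)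
Lemma altdiff_change0 (R : pzRingType) (n : nat) (u v : nat -> R) :
  (forall i, u i.+1 = v i.+1) -> altdiff R n u = u 0%N - v 0%N + altdiff R n v.
Proof.
move=> uv; rewrite /altdiff !big_nat_recl // bin0 expr0 !mul1r addrA subrK.
by congr (_ + _); apply: eq_bigr => i _; rewrite uv.
Qed.

Lemma altdiff_cst (R : pzRingType) (n : nat) (c : R) :
  (0 < n)%N -> altdiff R n (fun=> c) = 0.
Proof. by case: n => // n _; rewrite altdiffS subrr. Qed.

Lemma altdiffD (R : pzRingType) (n : nat) (u v : nat -> R) :
  altdiff R n (fun i => u i + v i) = altdiff R n u + altdiff R n v.
Proof. by rewrite /altdiff -big_split; apply: eq_bigr => i _; rewrite mulrDr. Qed.

Lemma altdiffZ (R : comPzRingType) (n : nat) (c : R) (u : nat -> R) :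
  altdiff R n (fun i => c * u i) = c * altdiff R n u.
Proof. by rewrite /altdiff mulr_sumr; apply: eq_bigr => i _; rewrite mulrCA. Qed.

(** Induction with [a] general, since shifting the sequence replaces [a] by [a + 1]. With [P] the
    common factors, the step is $\frac1{aP}-\frac1{P(a+1+n)}=\frac{n+1}{aP(a+1+n)}$. *)
Lemma altdiff_inv (R : numFieldType) (n : nat) (a : R) : 0 < a ->
  altdiff R n (fun i => (a + i%:R)^-1) =
  (n`!)%:R / \prod_(0 <= i < n.+1) (a + i%:R).
Proof.
elim: n a => [|n IHn] a a_gt0.
  by rewrite /altdiff !big_nat1 bin0 expr0 !mul1r.
have S i : a + i.+1%:R = a + 1 + i%:R by rewrite -natr1; ring.
have nz (b : R) : 0 < b -> b != 0 by move/lt0r_neq0.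
have a1_gt0 : 0 < a + 1 by rewrite addr_gt0.
have an_gt0 : 0 < a + 1 + n%:R by rewrite ltr_wpDr.
rewrite altdiffS (eq_altdiff _ _ _ _ (fun i => congr1 GRing.inv (S i))) !IHn //.
pose P := \prod_(0 <= i < n) (a + 1 + i%:R).
have P_gt0 : 0 < P by apply: prodr_gt0 => i _; rewrite ltr_wpDr.
have shift k : \prod_(0 <= i < k.+1) (a + i%:R) =
    a * \prod_(0 <= i < k) (a + 1 + i%:R).
  by rewrite big_nat_recl // addr0; under eq_bigr => i _ do rewrite S.
have last : \prod_(0 <= i < n.+1) (a + 1 + i%:R) = P * (a + 1 + n%:R).
  by rewrite big_nat_recr.
rewrite !shift last -/P factS natrM -natr1.
by field; rewrite !nz.
Qed.

Lemma altdiff_inv_gt0 (R : numFieldType) (n : nat) (a : R) : 0 < a ->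
  0 < altdiff R n (fun i => (a + i%:R)^-1).
Proof.
move=> a_gt0; rewrite altdiff_inv // divr_gt0 ?ltr0n ?fact_gt0 //.
by apply: prodr_gt0 => i _; rewrite ltr_wpDr.
Qed.

Section PerturbedAgler.
Variables (R : realType) (j : nat) (j_ge1 : (1 <= j)%N) (x : R) (x_gt0 : 0 < x).
Let W := perturbed_agler j_ge1 x_gt0.

Lemma squared_weights_perturbed_agler0 : squared_weights W 0 = x / j%:R.
Proof. by rewrite /squared_weights /= sqr_sqrtr // divr_ge0 ?ler0n ?ltW. Qed.

Lemma squared_weights_perturbed_aglerS n :
  squared_weights W n.+1 = 1 - (j%:R - 1) * (j%:R + n.+1%:R)^-1.
Proof.
rewrite /squared_weights /= sqr_sqrtr ?divr_ge0 ?ler0n //.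
have : j%:R + n.+1%:R != 0 :> R by rewrite -natrD pnatr_eq0 addnS.
by rewrite addnC natrD -[n.+2%:R]natr1 => ?; field; rewrite nat1r.
Qed.

Lemma altdiff_agler m a : (0 < m)%N ->
  altdiff R m (fun i => 1 - (j%:R - 1) * (a + i%:R)^-1) =
  - ((j%:R - 1) * altdiff R m (fun i => (a + i%:R)^-1)).
Proof.
move=> m_gt0; rewrite altdiffD altdiff_cst // add0r -mulNr -altdiffZ.
by apply: eq_altdiff => i; rewrite mulNr.
Qed.

Lemma alternating_perturbed_agler m : (0 < m)%N ->
  alternating m (squared_weights W) <->
  x <= 1 + ((j%:R - 1) * (m`!)%:R) / \prod_(1 <= i < m.+1) (j + i)%:R.
Proof.
move=> m_gt0; have j_gt0 : 0 < j%:R :> R by rewrite ltr0n.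
have j1_ge0 : 0 <= j%:R - 1 :> R by rewrite subr_ge0 ler1n.
rewrite -lerBlDl; set B := (X in _ <= X).
have diff0 : altdiff R m (squared_weights W) = (x - 1 - B) / j%:R.
  (* The comparison sequence is unperturbed, with value $1/j$ at 0. The factor $i=0$ of the product
     in [altdiff_inv] is $j$, hence the overall denominator. *)
  rewrite (altdiff_change0 _ _ _ (fun i => 1 - (j%:R - 1) * (j%:R + i%:R)^-1)).
    rewrite altdiff_agler // altdiff_inv // big_nat_recl // addr0.
    rewrite squared_weights_perturbed_agler0 /B big_add1 /=.
    under [in RHS]eq_bigr => i _ do rewrite natrD.
    have : 0 < \prod_(0 <= i < m) (j%:R + i.+1%:R) :> R.
      by apply: prodr_gt0 => i _; rewrite ltr_wpDr.
    by move=> /lt0r_neq0 ?; field; rewrite lt0r_neq0.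
  by move=> i; rewrite squared_weights_perturbed_aglerS.
have diff0_le0 : (altdiff R m (squared_weights W) <= 0) = (x - 1 <= B).
  by rewrite diff0 pmulr_lle0 ?invr_gt0 // subr_le0.
split=> [/(_ 0%N)|le_xB [|k]]; first by rewrite -diff0_le0.
  by rewrite -diff0_le0 in le_xB.
have jk_gt0 : 0 < j%:R + k.+1%:R :> R by rewrite addr_gt0.
(* From index 1 on, the perturbed weight is out of sight, and the closed form applies with base
   point $j+k+1$. *)
suff /(eq_altdiff _ m) : (fun i => squared_weights W (k.+1 + i)) =1
    (fun i => 1 - (j%:R - 1) * (j%:R + k.+1%:R + i%:R)^-1).
  rewrite /altdiff => ->; rewrite -/(altdiff _ _ _) altdiff_agler // oppr_le0.
  by rewrite mulr_ge0 // ltW // altdiff_inv_gt0.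
by move=> i; rewrite addSn squared_weights_perturbed_aglerS -addSn natrD addrA.
Qed.

End PerturbedAgler.

Section PerturbedBergman.
Variables (R : realType) (j_ge1 : (1 <= 2)%N) (x : R) (x_gt0 : 0 < x).
Let W := perturbed_agler j_ge1 x_gt0.

(** The product telescopes. At index 0 the same formula would give [x], whereas the moment is 1. *)
Lemma moment_perturbed_bergman n : moment W n.+1 = x * (1 + n.+1%:R)^-1.
Proof.
elim: n => [|n IHn].
  by rewrite /moment big_nat1 [LHS]squared_weights_perturbed_agler0.
rewrite /moment big_nat_recr //= -/(moment W n.+1) IHn.
have /= := squared_weights_perturbed_aglerS _ _ j_ge1 _ x_gt0 n.
rewrite /squared_weights /= => ->.
have : 0 <= n%:R :> R by [].
rewrite -[n.+2%:R]natr1 -[n.+1%:R]natr1 => n_ge0.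
by field; apply/andP; split; apply: lt0r_neq0; lra.
Qed.

Lemma contractive_perturbed_bergman n : (0 < n)%N ->
  contractive n W <-> x <= 1 + n%:R^-1.
Proof.
move=> n_gt0; have n0 : 0 < n%:R :> R by rewrite ltr0n.
have diff0 : altdiff R n (moment W) = 1 - x + x / n.+1%:R.
  rewrite (altdiff_change0 _ _ _ (fun i => x * (1 + i%:R)^-1)).
    rewrite altdiffZ altdiff_inv // /moment big_nil addr0 invr1 mulr1.
    under eq_bigr => i _ do rewrite addrC natr1.
    have prodE : (\prod_(0 <= i < n.+1) i.+1 = n.+1`!)%N.
      by rewrite fact_prod big_add1.
    rewrite -natr_prod prodE factS natrM.
    have : (n`!)%:R != 0 :> R by rewrite pnatr_eq0 -lt0n fact_gt0.
    by move=> ?; field; rewrite nat1r pnatr_eq0.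
  by move=> i; rewrite moment_perturbed_bergman.
have diff0_ge0 : (0 <= altdiff R n (moment W)) = (x <= 1 + n%:R^-1).
  (* The positive factor $n/(n+1)$ is pulled out of $1 - xn/(n+1)$, so the sign is that of
     $1+1/n-x$. *)
  have -> : altdiff R n (moment W) =
      (1 + n%:R^-1 - x) * (n%:R / n.+1%:R).
    by rewrite diff0 -natr1; field; rewrite !lt0r_neq0 // addr_gt0.
  by rewrite pmulr_lge0 ?divr_gt0 // subr_ge0.
split=> [/(_ 0%N)|le_x [|l]]; first by rewrite -diff0_ge0.
  by rewrite -diff0_ge0 in le_x.
have l_gt0 : 0 < 1 + l.+1%:R :> R by rewrite addr_gt0.
suff /(eq_altdiff _ n) : (fun i => moment W (l.+1 + i)) =1
    (fun i => x * (1 + l.+1%:R + i%:R)^-1).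
  rewrite /altdiff => ->; rewrite -/(altdiff _ _ _) altdiffZ.
  by rewrite mulr_ge0 ?ltW // altdiff_inv_gt0.
by move=> i; rewrite addSn moment_perturbed_bergman -addSn natrD addrA.
Qed.

End PerturbedBergman.

(** One of two consecutive integers is even, so the truncated division is exact. *)
Lemma half_mul_succ (m : nat) : ((m.+1 * m.+2) %/ 2 * 2 = m.+1 * m.+2)%N.
Proof. by rewrite divnK // dvdn2 oddM /= negbK andNb. Qed.

(** Both sides are $(m+2)!$. *)
Lemma prod_add2 (m : nat) :
  (2 * \prod_(1 <= i < m.+1) (2 + i) = m`! * (m.+1 * m.+2))%N.
Proof.
elim: m => [|m IHm]; first by rewrite big_nil.
by rewrite big_nat_recr //= mulnA IHm factS; ring.
Qed.

Theorem proposition1p6 (R : realType) (j : nat) (j_ge1 : (1 <= j)%N)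
    (x : R) (x_gt0 : 0 < x) (m : nat) (m_ge1 : (1 <= m)%N) :
  (alternating m (squared_weights (perturbed_agler j_ge1 x_gt0)) <->
     x <= 1 + ((j%:R - 1) * (m`!)%:R) / \prod_(1 <= i < m.+1) (j + i)%:R) /\
  (j = 2%N ->
     (alternating m (squared_weights (perturbed_agler j_ge1 x_gt0)) <->
      contractive ((m.+1 * m.+2) %/ 2) (perturbed_agler j_ge1 x_gt0))).
Proof.
have altP := alternating_perturbed_agler _ _ j_ge1 _ x_gt0 _ m_ge1.
split=> // j2; subst j.
set N := (_ %/ 2)%N.
have N2 : (N * 2 = m.+1 * m.+2)%N by exact: half_mul_succ.
have N_gt0 : (0 < N)%N by rewrite -(ltn_pmul2r (isT : 0 < 2)%N) N2.
(* For $j=2$ the product is $(m+2)!/2 = m!\,N$, so the bound on [x] becomes $1+1/N$, the threshold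
   for [N]-contractivity. *)
suff E : (2%:R - 1) * (m`!)%:R / \prod_(1 <= i < m.+1) (2 + i)%:R = N%:R^-1 :> R.
  by rewrite altP E; apply: iff_sym; apply: contractive_perturbed_bergman.
have prodE : (\prod_(1 <= i < m.+1) (2 + i) = m`! * N)%N.
  by apply/eqP; rewrite -(eqn_pmul2l (isT : 0 < 2)%N) prod_add2 -N2; apply/eqP; ring.
rewrite -natr_prod prodE natrM; field.
by rewrite !pnatr_eq0 -!lt0n N_gt0 fact_gt0.
Qed.
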